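(* Let $a,d,k$ be positive integers with $\gcd(a,d)=1$, and let $S_A=\langle a,a+d,a+2d,\ldots,a+kd\rangle$. Suppose that $d\ge 3$ and $a+kd\ge 4kd^3$. Let $\mu$, $j$, $\alpha_1,\ldots,\alpha_{n+1}$ be the integers attached to $(a,d,k)$ as defined in the context, and let $h(a,d,k)=\left(a-\left((\mu-k)d+\alpha_{j+1}\right)\right)^2$. Then the largest perfect square ${}^{2}r(S_A)$ not belonging to $S_A$ satisfies $$ {}^{2}r(S_A)\le h(a,d,k). $$
   Context: For positive integers $s_1,\dots,s_n$, $\langle s_1,\dots,s_n\rangle=\{\sum_i x_is_i : x_i \text{ integers},\ x_i\ge 0\}$. For a numerical semigroup $S$ with $1\notin S$ (generated by relatively prime positive integers), ${}^{2}r(S)$ denotes the largest perfect square $m^2$ ($m\ge 1$ an integer) not belonging to $S$. For relatively prime positive integers $a,d$ and any integer $i$, $\lambda_i$ is the unique integer in $\{0,1,\ldots,d-1\}$ such that $\lambda_i a+i^2\equiv 0 \pmod d$. Put $\lambda^*=\max_{0\le i\le d-1}\lambda_i$. Let $\alpha_1<\cdots<\alpha_n$ be all the elements $\alpha$ of $\{0,1,\ldots,d-1\}$ with $\lambda_\alpha=\lambda^*$, and put $\alpha_{n+1}=d+\alpha_1$. For a positive integer $k$, let $j\in\{1,\ldots,n\}$ be the (unique) index and $\mu\ge 0$ the (unique) integer such that $$(\mu d+\alpha_j)^2\le (kd-\lambda^* )(a+kd)<(\mu d+\alpha_{j+1})^2 .$$ *)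

(* Defs.v *)
From mathcomp Require Import all_boot all_order all_algebra.
From mathcomp Require Import ring.

Set Implicit Arguments.
Unset Strict Implicit.
Unset Printing Implicit Defensive.

Import GRing.Theory.

Definition semigroup_gen (s : seq nat) (m : nat) : Prop :=
  exists x : 'I_(size s) -> nat, m = \sum_(i < size s) x i * nth 0 s i.

Definition S_A (a d k : nat) : nat -> Prop :=
  semigroup_gen [seq a + i * d | i <- iota 0 k.+1].

Definition is_largest_square_notin (S : nat -> Prop) (r : nat) : Prop :=
  (exists2 m : nat, 0 < m & r = m ^ 2) /\ ~ S r /\
  (forall m : nat, 0 < m -> ~ S (m ^ 2) -> m ^ 2 <= r).

(* The default 0 is never reached when [a] and [d] are coprime and [d > 0];
   see [lambdaP] and [lambda_uniq] below. *)
Definition lambda (a d : nat) (i : int) : nat :=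
  if [pick l : 'I_d | (d%:Z %| (l : nat)%:Z * a%:Z + i ^+ 2)%Z]%R is Some l
  then nat_of_ord l else 0.

Lemma lambda_uniq (a d : nat) (i : int) (l l' : 'I_d) : coprime a d ->
  (d%:Z %| (l : nat)%:Z * a%:Z + i ^+ 2)%Z%R ->
  (d%:Z %| (l' : nat)%:Z * a%:Z + i ^+ 2)%Z%R -> l = l'.
Proof.
move=> co h h'; have := rpredB h h'.
rewrite opprD addrACA subrr addr0 -mulrBl Gauss_dvdzl; last first.
  by rewrite coprimezE /= coprime_sym.
rewrite -eqz_mod_dvd !modz_nat eqz_nat => /eqP e; apply: val_inj => /=.
by move: e; rewrite !modn_small.
Qed.

Lemma lambdaP (a d : nat) (i : int) : 0 < d -> coprime a d ->
  lambda a d i < d /\ (d%:Z %| (lambda a d i)%:Z * a%:Z + i ^+ 2)%Z%R.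
Proof.
move=> d0 co; rewrite /lambda; case: pickP => [l hl|no]; first by split.
exfalso; have /coprimezP [[u v] /= uv] : coprimez (Posz a) (Posz d) by rewrite coprimezE.
have dn0 : (d%:Z != 0)%R by rewrite eqz_nat -lt0n.
pose w := (- (u * i ^+ 2))%R.
have w0 : (0 <= w %% d%:Z)%Z%R by rewrite modz_ge0.
have wd : `|(w %% d%:Z)%Z|%N < d.
  by rewrite -ltz_nat gez0_abs // ltz_pmod // ltz_nat.
have /negP := negbT (no (Ordinal wd)); apply => /=.
rewrite gez0_abs //; apply/dvdzP; exists (v * i ^+ 2 - (w %/ d%:Z)%Z * a%:Z)%R.
have ew : (w %% d%:Z)%Z = (w - (w %/ d%:Z)%Z * d%:Z)%R.
  by rewrite {2}(divz_eq w (Posz d)) addrC addKr.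
rewrite ew /w; set q := (_ %/ _)%Z; rewrite -[X in (_ + X)%R]mul1r -uv; ring.
Qed.

Definition lambda_star (a d : nat) : nat :=
  \max_(i < d) lambda a d (i : nat)%:Z%R.

Definition alphas (a d : nat) : seq nat :=
  [seq i <- iota 0 d | lambda a d i%:Z%R == lambda_star a d].

(* 1-based: [alpha a d j] for [1 <= j <= n], [n] being [size (alphas a d)],
   lists [alphas a d] in increasing order, and
   [alpha a d n.+1 = d + alpha a d 1]. *)
Definition alpha (a d j : nat) : nat :=
  nth 0 (rcons (alphas a d) (d + head 0 (alphas a d))) j.-1.

Local Open Scope ring_scope.

Definition mu_j_spec (a d k mu j : nat) : Prop :=
  [/\ (1 <= j <= size (alphas a d))%N,
      ((mu * d + alpha a d j) ^ 2)%N%:Z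
        <= ((k * d)%N%:Z - (lambda_star a d)%:Z) * (a + k * d)%N%:Z
    & ((k * d)%N%:Z - (lambda_star a d)%:Z) * (a + k * d)%N%:Z
        < ((mu * d + alpha a d j.+1) ^ 2)%N%:Z].

(* In int: [mu - k] and [a - _] may be negative. *)
Definition h (a d k mu j : nat) : int :=
  (a%:Z - ((mu%:Z - k%:Z) * d%:Z + (alpha a d j.+1)%:Z)) ^+ 2.

(* Main.v *)
Require Import Defs.
From mathcomp Require Import all_boot all_order all_algebra.
From mathcomp Require Import zify ring.

(** Write P = a + k * d, and a square as m ^ 2 with m = P - I. The element
    X * a + Y * d of [S_A] uses X generators, and with X generators the values
    Y = 0, ..., k * X are exactly those that occur ([S_AP]).

    Modulo d the number l = [lambda a d I] is such that l * a + I ^ 2 vanishes,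
    and this gives an explicit pair (X, Y) for m ^ 2: with i = I - k * d, so that
    m = a - i, one has
      m ^ 2 = (a - 2 * i - l) * a + (l * a + i ^ 2) / d * d,
    and here Y <= k * X amounts to I ^ 2 <= (k * d - l) * P ([S_A_square]).
    The residues of I with l = [lambda_star a d] make this test hardest. Let
    x = mu * d + alpha_j, the lower of the two consecutive integers that
    enclose the square root of (k * d - lambda_star) * P among those residues,
    and let I' = mu * d + alpha_(j+1) be the next one, so that
    [h a d k mu j] = (P - I') ^ 2. Any I with 0 <= I < I' passes:
    - if I is in a hardest residue class then I <= x ([alpha_succ]), and x
      passes by the choice of mu and j;
    - otherwise l <= lambda_star - 1, so the right-hand side has an extra P to
      spare, which covers the passage from x to I <= x + d - 1 because P is
      large with respect to k * d ^ 3 ([sqr_lt_addn_slack]).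

    The remaining squares, those with m >= P, are beyond the range where
    residues matter at all ([S_A_large]). Hence no square above (P - I') ^ 2 is
    missing from [S_A], while 1 is missing, so a largest missing square exists
    and is at most [h a d k mu j]. *)

Set Implicit Arguments.
Unset Strict Implicit.
Unset Printing Implicit Defensive.

Import GRing.Theory Num.Theory.

(** * Membership in the semigroup *)

Lemma semigroup_gen0 (s : seq nat) : semigroup_gen s 0.
Proof. by exists (fun=> 0); rewrite big1. Qed.

Lemma semigroup_genD (s : seq nat) (m g : nat) :
  g \in s -> semigroup_gen s m -> semigroup_gen s (g + m).
Proof.
move=> /(nthP 0) [i lt_i <-] [x ->].
exists (fun l => (l == Ordinal lt_i) + x l).
under [RHS]eq_bigr => l _ do rewrite mulnDl.
rewrite big_split /=; congr (_ + _).
rewrite (bigD1 (Ordinal lt_i)) //= eqxx mul1n big1 ?addn0 // => l /negPf ->.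
by rewrite mul0n.
Qed.

(** X counts the generators used and Y adds up their indices in 0, ..., k.
    Conversely, a total Y <= k * X is shared out greedily: each generator takes
    index k until what remains is smaller. *)
Lemma S_AP (a d k M : nat) :
  S_A a d k M <-> exists X Y : nat, Y <= k * X /\ M = X * a + Y * d.
Proof.
split=> [[x ->]|[X [Y [le_Y ->]]]].
  exists (\sum_i x i), (\sum_i x i * i); split.
    rewrite big_distrr /=; apply: leq_sum => i _; rewrite mulnC leq_mul2r.
    by have := ltn_ord i; rewrite {2}size_map size_iota ltnS => ->; rewrite orbT.
  rewrite !big_distrl -big_split; apply: eq_bigr => i _.
  have := ltn_ord i; rewrite {2}size_map size_iota => lt_i.
  by rewrite (nth_map 0) ?size_iota // nth_iota // add0n mulnDr mulnA.
elim: X Y le_Y => [|X IHX] Y le_Y.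
  by move: le_Y; rewrite muln0 leqn0 => /eqP ->; apply: semigroup_gen0.
have -> : X.+1 * a + Y * d
    = (a + minn Y k * d) + (X * a + (Y - minn Y k) * d).
  by rewrite mulSn addnACA -mulnDl subnKC // geq_minl.
apply: semigroup_genD; last by apply: IHX; lia.
by apply/mapP; exists (minn Y k) => //; rewrite mem_iota; lia.
Qed.

(** A boolean form of membership, used to extract a maximum: for a > 0, both
    numbers in a representation of M are bounded in terms of M. *)
Definition in_S_A (a d k M : nat) : bool :=
  [exists X : 'I_M.+1, exists Y : 'I_(k * M).+1,
     (Y <= k * X) && (M == X * a + Y * d)].

Lemma in_S_AP (a d k M : nat) : 0 < a ->
  reflect (S_A a d k M) (in_S_A a d k M).
Proof.
move=> a0; apply: (iffP idP) => [|/S_AP[X [Y [le_Y eM]]]].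
  move=> /existsP[X /existsP[Y /andP[le_Y /eqP eM]]].
  by apply/S_AP; exists X, Y.
have le_X : X < M.+1 by rewrite eM ltnS; nia.
have lt_Y : Y < (k * M).+1.
  by rewrite ltnS (leq_trans le_Y) // leq_mul2l -ltnS le_X orbT.
apply/existsP; exists (Ordinal le_X); apply/existsP; exists (Ordinal lt_Y).
by rewrite /= le_Y -eM eqxx.
Qed.

Lemma one_notin_S_A (a d k : nat) : 1 < a -> ~ S_A a d k 1.
Proof. by move=> a1 /S_AP[[|X] [Y [le_Y e]]]; nia. Qed.

(** A Frobenius-type bound. The representations of M correspond to the integers
    X in the interval from M / (a + k * d) to M / a that have one prescribed
    residue modulo d. The length of this interval is
    k * d * M / (a * (a + k * d)), which is at least d under the hypothesis on
    M, so every residue occurs. *)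
Lemma S_A_large (a d k M : nat) : 0 < a -> 0 < d -> coprime a d ->
  a * (a + k * d) <= k * M -> S_A a d k M.
Proof.
move=> a0 d0 co le_M; apply/S_AP.
have [u eu] : exists u, u * a = M %[mod d].
  exists (chinese a d 0 M %/ a).
  by rewrite divnK ?chinese_modr // /dvdn chinese_modl // mod0n.
(* X = q - t is the largest integer that is at most M / a and congruent to u;
   d.-1 * u stands for - u. *)
pose q := M %/ a.
pose t := (q + d.-1 * u) %% d.
have lt_t : t < d by rewrite ltn_mod.
have le_q : q * a <= M by rewrite leq_trunc_div.
have gt_q : M < q.+1 * a by rewrite ltn_ceil.
(* In other words q - t >= M / (a + k * d): the length of the interval enters. *)
have gt_tq : M + t * (a + k * d) <= q * (a + k * d).
  have le_q1 : M + d * (a + k * d) <= q.+1 * (a + k * d).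
    rewrite -(leq_pmul2l a0).
    have -> : a * (M + d * (a + k * d)) = a * M + d * (a * (a + k * d))
      by ring.
    have -> : a * (q.+1 * (a + k * d)) = q.+1 * a * (a + k * d) by ring.
    apply: leq_trans (leq_mul (ltnW gt_q) (leqnn _)).
    have -> : M * (a + k * d) = a * M + d * (k * M) by ring.
    by rewrite leq_add2l leq_mul2l le_M orbT.
  have := leq_mul lt_t (leqnn (a + k * d)); move: le_q1; rewrite !mulSn.
  by set P := a + k * d; lia.
have le_tq : t <= q.
  have P_gt0 : 0 < a + k * d by rewrite addn_gt0 a0.
  by rewrite -(leq_pmul2r P_gt0) (leq_trans _ gt_tq) ?leq_addl.
have eM : (q - t) * a = M %[mod d].
  rewrite -eu -modnMml -[in RHS]modnMml; congr (_ * _ %% _).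
  apply/eqP; rewrite -(eqn_modDr t) subnK // /t modnDmr addnCA -mulSn prednK //.
  by rewrite mulnC addnC modnMDl.
have le_M1 : (q - t) * a <= M.
  by rewrite (leq_trans _ le_q) // leq_mul2r leq_subr orbT.
exists (q - t), ((M - (q - t) * a) %/ d).
have dv : d %| M - (q - t) * a by rewrite -eqn_mod_dvd // eM.
split; last by rewrite divnK // subnKC.
rewrite -(leq_pmul2r d0) divnK // leq_subLR.
by rewrite -mulnA mulnCA -mulnDr mulnBl leq_subRL 1?addnC // leq_mul2r le_tq orbT.
Qed.

(** The sufficient test for m = a + k * d - I. The last hypothesis is
    I ^ 2 <= (k * d - l) * (a + k * d) written without subtraction; it is
    (a + k * d) * l + (i + k * d) ^ 2 <= k * d * (a + k * d) for i = I - k * d,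
    which simplifies to l * a + i ^ 2 <= k * d * (a - 2 * i - l). *)
Lemma S_A_square (a d k l m I : nat) : 0 < d -> 0 < k ->
  m + I = a + k * d -> d %| l * a + I ^ 2 ->
  I ^ 2 + l * (a + k * d) <= k * d * (a + k * d) -> S_A a d k (m ^ 2).
Proof.
move=> d0 k0 emI dvd le_I; apply/S_AP.
pose i : int := (I%:Z - (k * d)%N%:Z)%R.
have [y ey] : exists y : int, (l%:Z * a%:Z + i ^+ 2 = y * d%:Z)%R.
  have /dvdnP[z ez] := dvd.
  (* i ^ 2 and I ^ 2 differ by a multiple of d. *)
  exists (z%:Z + (k * k * d)%N%:Z - 2 * k%:Z * I%:Z)%R.
  by rewrite /i; nia.
pose x : int := (a%:Z - 2 * i - l%:Z)%R.
have y0 : (0 <= y)%R.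
  have : (0 <= y * d%:Z)%R by rewrite -ey; nia.
  nia.
have le_yx : (y <= k%:Z * x)%R.
  have : (y * d%:Z <= k%:Z * x * d%:Z)%R.
    by rewrite -ey /x /i; nia.
  by rewrite ler_pM2r // ltz_nat.
have x0 : (0 <= x)%R by nia.
exists `|x|%N, `|y|%N; split; first by nia.
have em : (m%:Z = a%:Z - i)%R by rewrite /i; lia.
have : (m%:Z ^+ 2 = x * a%:Z + y * d%:Z)%R by rewrite -ey em /x; ring.
rewrite -{1}(gez0_abs x0) -{1}(gez0_abs y0) -!PoszM -PoszD => -[] <-.
by rewrite mulnn.
Qed.

(** * The residues lambda and their maximum *)

Lemma lambda_modn (a d I : nat) : 0 < d ->
  lambda a d (I %% d)%N%:Z%R = lambda a d I%:Z%R.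
Proof.
move=> d0; rewrite /lambda; congr (if _ is Some l then _ else _).
apply: eq_pick => l /=.
have e : (d%:Z %| I%:Z ^+ 2 - (I %% d)%N%:Z ^+ 2)%Z%R.
  by rewrite subr_sqr dvdz_mulr // -eqz_mod_dvd !modz_nat modn_mod.
rewrite -[in RHS](subrK ((I %% d)%N%:Z ^+ 2)%R (I%:Z ^+ 2)%R).
by rewrite [in RHS]addrCA [in RHS]rpredDl.
Qed.

Lemma dvdn_lambda (a d I : nat) : 0 < d -> coprime a d ->
  d %| lambda a d I%:Z%R * a + I ^ 2.
Proof.
move=> d0 co; have [_] := lambdaP I%:Z%R d0 co.
by rewrite -PoszM -[(I%:Z ^+ 2)%R]/(Posz (I * I)) -PoszD dvdzE /= -mulnn.
Qed.

Lemma lambda_le_star (a d I : nat) : 0 < d ->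
  lambda a d I%:Z%R <= lambda_star a d.
Proof.
move=> d0; rewrite -lambda_modn //.
have lt_I : I %% d < d by rewrite ltn_mod.
exact: (@leq_bigmax _ (fun i : 'I_d => lambda a d (i : nat)%:Z%R)
  (Ordinal lt_I)).
Qed.

Lemma lambda_star_lt (a d : nat) : 0 < d -> coprime a d -> lambda_star a d < d.
Proof.
move=> d0 co; rewrite -(prednK d0) ltnS prednK //; apply/bigmax_leqP => i _.
by have [] := lambdaP (i : nat)%:Z%R d0 co; lia.
Qed.

Lemma nth_alphas_lt (a d t : nat) : 0 < d -> nth 0 (alphas a d) t < d.
Proof.
move=> d0; have [lt_t|le_t] := ltnP t (size (alphas a d)); last first.
  by rewrite nth_default.
by have := mem_nth 0 lt_t; rewrite mem_filter mem_iota => /andP[].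
Qed.

Lemma alphaE (a d j : nat) : 0 < j <= size (alphas a d) ->
  alpha a d j = nth 0 (alphas a d) j.-1.
Proof. by rewrite /alpha nth_rcons; case: j => //= j ->. Qed.

(** The numbers mu * d + alpha_j, with mu >= 0 and 1 <= j <= n, list in
    increasing order all naturals at which lambda is maximal, and
    mu * d + alpha_(n+1) = (mu + 1) * d + alpha_1 is the successor of
    mu * d + alpha_n. *)
Lemma alpha_succ (a d j mu : nat) : 0 < d -> 0 < j <= size (alphas a d) ->
  alpha a d j.+1 <= alpha a d j + d /\
  forall I, lambda a d I%:Z%R = lambda_star a d ->
    I < mu * d + alpha a d j.+1 -> I <= mu * d + alpha a d j.
Proof.
move=> d0 j_range; rewrite (alphaE j_range).
set s := alphas a d in j_range *.
have s_lt t : nth 0 s t < d by apply: nth_alphas_lt.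
have s_mono t u : t <= u -> u < size s -> nth 0 s t <= nth 0 s u.
  move=> le_tu lt_u; apply: (sorted_leq_nth leq_trans leqnn) => //.
  - by apply: sorted_filter; [apply: leq_trans | apply: iota_sorted].
  - exact: leq_ltn_trans lt_u.
have s_rank I : lambda a d I%:Z%R = lambda_star a d ->
    exists q t, t < size s /\ I = q * d + nth 0 s t.
  move=> eI; have : I %% d \in s.
    by rewrite mem_filter lambda_modn // eI eqxx mem_iota ltn_mod.
  by move=> /(nthP 0)[t lt_t et]; exists (I %/ d), t; rewrite et -divn_eq.
(* Linear facts to compare I = q * d + alpha with mu * d + alpha'. *)
have block q : [\/ q * d + d <= mu * d, q * d = mu * d | mu * d + d <= q * d].
  have [lt_q|gt_q|->] := ltngtP q mu; last by constructor 2.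
    by constructor 1; rewrite addnC -mulSn leq_mul.
  by constructor 3; rewrite addnC -mulSn leq_mul.
have -> : alpha a d j.+1 = if j < size s then nth 0 s j else d + nth 0 s 0.
  by rewrite /alpha nth_rcons /= -/s -nth0; case: ltnP => // ?; rewrite ifT; lia.
have [lt_j|le_j] := ltnP j (size s).
  split=> [|I /s_rank[q [t [lt_t ->]]]]; first by have := s_lt j; lia.
  have := s_lt t; have := s_lt j.
  have [le_jt|lt_tj] := leqP j t.
    by have := s_mono _ _ le_jt lt_t; case: (block q); lia.
  by have := s_mono t j.-1 ltac:(lia) ltac:(lia); case: (block q); lia.
have le_s0 t : t < size s -> nth 0 s 0 <= nth 0 s t by apply: s_mono.
split=> [|I /s_rank[q [t [lt_t ->]]]]; first by have := le_s0 j.-1; lia.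
have := s_mono t j.-1 ltac:(lia) ltac:(lia); have := le_s0 t lt_t.
by have := s_lt t; case: (block q); lia.
Qed.

(** * Room given by the size of a + k * d *)

Lemma leq_of_sqr_le (x d k P : nat) :
  4 * k * d ^ 3 <= P -> x ^ 2 <= k * d * P -> 2 * x * d <= P.
Proof.
move=> le_P le_x; rewrite -(leq_exp2r _ _ (isT : 0 < 2)).
have -> : (2 * x * d) ^ 2 = 4 * d ^ 2 * x ^ 2 by ring.
apply: leq_trans (leq_mul (leqnn (4 * d ^ 2)) le_x) _.
have -> : 4 * d ^ 2 * (k * d * P) = 4 * k * d ^ 3 * P by ring.
by rewrite -mulnn leq_mul.
Qed.

(** The increase of the square from x to x + d - 1 is
    2 * x * (d - 1) + (d - 1) ^ 2. Its first term is at most P - P / d, and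
    the missing P / d >= d ^ 2 pays for the second one. *)
Lemma sqr_lt_addn_slack (x d P c I : nat) : 0 < d -> d ^ 3 <= P ->
  2 * x * d <= P -> x ^ 2 <= c * P -> I < x + d -> I ^ 2 <= c.+1 * P.
Proof.
move=> d0 le_dP le_xd le_x lt_I.
have le_incr : 2 * x * d.-1 + d.-1 ^ 2 <= P.
  rewrite -(leq_pmul2r d0) mulnDl.
  have -> : 2 * x * d.-1 * d = 2 * x * d * d.-1 by ring.
  have le1 : 2 * x * d * d.-1 <= P * d.-1 by rewrite leq_mul2r le_xd orbT.
  have le2 : d.-1 ^ 2 * d <= P.
    by apply: leq_trans le_dP; rewrite (expnSr d 2) leq_mul // leq_exp2r ?leq_pred.
  by rewrite -[X in P * X](prednK d0) mulnSr leq_add.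
apply: (@leq_trans ((x + d.-1) ^ 2)); first by rewrite leq_exp2r //; lia.
have -> : (x + d.-1) ^ 2 = (2 * x * d.-1 + d.-1 ^ 2) + x ^ 2 by ring.
by rewrite mulSn leq_add.
Qed.

Theorem theorem2p7 (a d k mu j : nat)
  (ha : 0 < a) (hd0 : 0 < d) (hk : 0 < k) (hcop : gcdn a d = 1)
  (hd : 3 <= d) (hlarge : 4 * k * d ^ 3 <= a + k * d)
  (hmuj : mu_j_spec a d k mu j) :
  exists r : nat,
    is_largest_square_notin (S_A a d k) r /\ (r%:Z <= h a d k mu j)%R.
Proof.
have co : coprime a d by apply/eqP.
have lt_star := lambda_star_lt hd0 co.
case: hmuj => j_range; set x := (mu * d + alpha a d j).
set I' := (mu * d + alpha a d j.+1) => le_x lt_I'.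
set P := (a + k * d) in hlarge le_x lt_I' *.
have le_star : lambda_star a d <= k * d by nia.
pose c := k * d - lambda_star a d.
have {}le_x : x ^ 2 <= c * P by move: le_x; rewrite subzn // -/c; lia.
have le_c : c <= k * d by rewrite leq_subr.
have le_xd : 2 * x * d <= P.
  apply: leq_of_sqr_le hlarge _.
  by rewrite (leq_trans le_x) // leq_mul2r le_c orbT.
have le_dP : d ^ 3 <= P by rewrite (leq_trans _ hlarge) // leq_pmull; lia.
have [le_I'x pred_I'] := alpha_succ mu hd0 j_range.
(* I' <= x + d, where x <= P / 6 and d <= P / 9 because d >= 3. *)
have lt_I'P : I' < P.
  have : 6 * x <= P by nia.
  have : 9 * d <= P by nia.
  by move: le_I'x; rewrite /I' /x; lia.
have sq_in m : ~ S_A a d k (m ^ 2) -> m <= P - I'.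
  move=> notS; rewrite leqNgt; apply/negP => lt_m; apply: notS.
  have [le_Pm|lt_mP] := leqP P m.
    apply: S_A_large => //; apply: leq_trans (leq_pmull _ hk).
    by rewrite -mulnn leq_mul // (leq_trans (leq_addr _ _) le_Pm).
  have [I eI] : exists I, m + I = P by exists (P - m); lia.
  have lt_I : I < I' by lia.
  apply: (S_A_square hd0 hk eI (dvdn_lambda I hd0 co)); rewrite -/P.
  have le_l := lambda_le_star a I hd0.
  suff : I ^ 2 <= (k * d - lambda a d I%:Z%R) * P.
    by rewrite mulnBl leq_subRL 1?addnC // leq_mul2r; lia.
  move: le_l; rewrite leq_eqVlt => /orP[/eqP e_l|lt_l].
    rewrite e_l (leq_trans _ le_x) // leq_exp2r // /x.
    exact: pred_I'.
  have lt_Ix : I < x + d by move: lt_I le_I'x; rewrite /I' /x; lia.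
  apply: leq_trans (sqr_lt_addn_slack hd0 le_dP le_xd le_x lt_Ix) _.
  by rewrite leq_mul2r /c; lia.
have ex1 : exists m, (0 < m) && ~~ in_S_A a d k (m ^ 2).
  by exists 1; rewrite exp1n /=; apply/in_S_AP => //; apply: one_notin_S_A; nia.
have bnd m : (0 < m) && ~~ in_S_A a d k (m ^ 2) -> m <= P - I'.
  by move=> /andP[_ /(in_S_AP _ _ _ ha)]; apply: sq_in.
case: (ex_maxnP ex1 bnd) => m m_in m_max.
have [m0 /(in_S_AP _ _ _ ha) notS] := andP m_in.
exists (m ^ 2); split.
  split; [by exists m | split=> // q q0 q_notS].
  by rewrite leq_exp2r // m_max // q0; apply/in_S_AP.
have le_m := bnd m m_in.
have -> : (h a d k mu j = ((P - I') ^ 2)%N%:Z)%R.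
  rewrite /h; have -> : (a%:Z - ((mu%:Z - k%:Z) * d%:Z + (alpha a d j.+1)%:Z)
    = (P - I')%N%:Z)%R by rewrite -subzn 1?ltnW // /P /I'; lia.
  by rewrite -mulnn PoszM.
by rewrite lez_nat leq_exp2r.
Qed.
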